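(* Let $p\in[1,\infty)$ and let $(X,\rho,\mu)$ be a doubling metric measure space supporting a $(1,p)$-Poincaré inequality with constants $(\lambda,c_P)$. Then there is a constant $C$, depending only on the doubling and Poincaré data ($c_\mu$, $p$, $\lambda$, $c_P$), such that for all $f\in L^1_{\mathrm{loc}}(\mu)$, all $z\in X$, and all $0<r<s<\infty$, $$m_f(z,s)\le C\,\frac sr\Big(\frac{1}{\mu(B(z,\tilde\lambda s))}\int_{B(z,\tilde\lambda s)}m_f(x,r)^p\,d\mu(x)\Big)^{1/p},$$ where $\tilde\lambda:=\max(2,\lambda)$.
   Context: A metric measure space $(X,\rho,\mu)$ is doubling if there is a constant $c_\mu$ with $\mu(B(x,2r))\le c_\mu\,\mu(B(x,r))$ for all $x\in X$, $r>0$, where $B(x,r)=\{y:\rho(x,y)<r\}$; as usual, all balls have positive and finite measure. $L^1_{\mathrm{loc}}(\mu)$ is the class of measurable $f$ with $1_Bf\in L^1(\mu)$ for every ball $B$. $\langle f\rangle_B:=\frac1{\mu(B)}\int_Bf\,d\mu$, and $$m_f(x,t):=\frac{1}{\mu(B(x,t))}\int_{B(x,t)}|f-\langle f\rangle_{B(x,t)}|\,d\mu .$$ Pointwise Lipschitz constant: $\operatorname{lip}f(x):=\liminf_{t\to0}\sup_{\rho(x,y)\le t}\frac{|f(x)-f(y)|}{t}$. $(1,p)$-Poincaré inequality with constants $(\lambda,c_P)$, $\lambda\in[1,\infty)$, $c_P\in(0,\infty)$: $$\frac{1}{\mu(B(z,r))}\int_{B(z,r)}|f-\langle f\rangle_{B(z,r)}|\,d\mu\le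 c_P\, r\Big(\frac{1}{\mu(B(z,\lambda r))}\int_{B(z,\lambda r)}(\operatorname{lip}f)^p\,d\mu\Big)^{1/p}$$ for all $z\in X$, $r>0$ and all Lipschitz functions $f$ on $X$. *)

(* Defs.v *)
From HB Require Import structures.
From mathcomp Require Import all_boot all_order all_algebra.
From mathcomp Require Import all_classical all_reals all_analysis.

Set Implicit Arguments.
Unset Strict Implicit.
Unset Printing Implicit Defensive.

Import Order.TTheory GRing.Theory Num.Theory.
Import numFieldNormedType.Exports.

Local Open Scope classical_set_scope.
Local Open Scope ring_scope.
Local Open Scope ereal_scope.

(* A metric space with a sigma-algebra on the same carrier. The two structures
   are linked only by [borel_compatible]. The library's [ball x r] is the open
   ball, and [ballEmdist] rewrites it to [[set y | mdist x y < r]]. *)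
#[short(type="metricMeasurableType")]
HB.structure Definition MetricMeasurable (R : numDomainType) d :=
  {X of Metric R X & Measurable d X}.

Section metric_measure_space.
Context {R : realType} {d : measure_display} {X : metricMeasurableType R d}.
Implicit Types (mu : {measure set X -> \bar R}) (f : X -> R).

(* The sigma-algebra may be larger than the Borel one, e.g. its completion. *)
Definition borel_compatible := forall A : set X, open A -> measurable A.

Definition balls_positive_finite mu := forall (x : X) (r : R), (0 < r)%R ->
  0 < mu (ball x r) < +oo.

Definition doubling mu (cmu : R) := forall (x : X) (r : R), (0 < r)%R ->
  mu (ball x (2 * r)%R) <= cmu%:E * mu (ball x r).

Definition L1loc mu f := measurable_fun setT f /\
  forall (x : X) (r : R), (0 < r)%R -> mu.-integrable (ball x r) (EFin \o f).

Definition average mu (B : set X) (g : X -> \bar R) : \bar R :=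
  (mu B)^-1 * \int[mu]_(y in B) g y.

Definition mean mu f (B : set X) : R := fine (average mu B (EFin \o f)).

Definition mean_osc mu f (x : X) (t : R) : \bar R :=
  average mu (ball x t) (fun y => `|f y - mean mu f (ball x t)|%:E).

(* The library's [lipschitz] is only available between normed modules. *)
Definition lipschitz_fun f :=
  exists L : R, forall x y : X, (`|f x - f y| <= L * mdist x y)%R.

Definition lip f (x : X) : \bar R :=
  limf_einf (fun t : R => ereal_sup
    [set (`|f x - f y| / t)%:E | y in [set y : X | (mdist x y <= t)%R]]) 0^'+.

Definition poincare mu (p lambda cP : R) :=
  forall f, lipschitz_fun f -> forall (z : X) (r : R), (0 < r)%R ->
    mean_osc mu f z r <=
    (cP * r)%:E *
      (average mu (ball z (lambda * r)%R) (fun y => lip f y `^ p)) `^ p^-1.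

End metric_measure_space.

Arguments borel_compatible {R d} X.

(* Main.v *)
Require Import Defs.
From HB Require Import structures.
From mathcomp Require Import all_boot all_order all_algebra.
From mathcomp Require Import all_classical all_reals all_analysis.
From mathcomp Require Import measurable_realfun.
From mathcomp Require Import ring lra.

Set Implicit Arguments.
Unset Strict Implicit.
Unset Printing Implicit Defensive.

Import Order.TTheory GRing.Theory Num.Theory.
Import numFieldNormedType.Exports.

Local Open Scope classical_set_scope.
Local Open Scope ring_scope.

(* Fix the scale delta = r / 4 and let f_delta be the average of f against the
   tent kernel max(0, 1 - rho(x, y) / delta), normalised to mass 1.  The kernel
   is Lipschitz in x and doubling bounds it by C / mu(B(u, r)) on B(u, r), so
   subtracting the mean of f over B(x, r) gives lip f_delta(x) <= (C / r) m_f(x, r),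
   and on B(u, 3 delta / 2) one has |f_delta - <f>_{B(u, r)}| <= C m_f(u, r).
   The Poincare inequality bounds m_{f_delta}(z, s) by the right-hand side.  For
   f - f_delta, cover B(z, s) by balls B(x_i, delta) around a delta-separated
   net: the integral over B(x_i, delta) is at most C mu(B(x_i, delta / 2)) m_f(u, r)
   for every u in B(x_i, delta / 2), and these smaller balls are disjoint in
   B(z, 2 s).  Only constants on those balls are compared with m_f(., r)^p, so
   neither measurability of m_f(., r) nor Fubini's theorem is needed.

   The Poincare inequality is assumed for globally Lipschitz functions only, and
   f_delta is one when f is bounded.  The general case follows by truncation,
   since m_{T f} <= 2 m_f for every 1-Lipschitz T. *)

(** * Comparison of integrals of nonnegative functions that may fail to be measurable *)

Section lower_integral.
Context {R : realType} {d : measure_display} {T : measurableType d}.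
Variable mu : {measure set T -> \bar R}.
Import HBNNSimple.

(* The functions need not be measurable: [integral] of a nonnegative function
   is a supremum over the simple functions below it. *)
Lemma ge0_le_integral_scale (D E : set T) (f g : T -> \bar R) (k : R) :
  0 < k -> D `<=` E ->
  (forall x, D x -> (0 <= f x)%E) -> (forall x, E x -> (0 <= g x)%E) ->
  (forall x, D x -> (f x <= k%:E * g x)%E) ->
  (\int[mu]_(x in D) f x <= k%:E * \int[mu]_(x in E) g x)%E.
Proof.
move=> k0 DE f0 g0 fg.
rewrite !ge0_integralE//; apply: ge_ereal_sup => _ [h /= hf <-].
have ki0 : 0 <= k^-1 by rewrite invr_ge0 ltW.
have -> : sintegral mu h = (k%:E * sintegral mu (scale_nnsfun h ki0))%E.
  by rewrite sintegralrM muleA -EFinM divff ?gt_eqF// mul1e.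
apply: lee_wpmul2l; first by rewrite lee_fin ltW.
apply: ereal_sup_ubound; exists (scale_nnsfun h ki0) => //= x.
have := hf x; rewrite /patch; case: ifPn => xD.
  have xD' := set_mem xD; have xE : x \in E by apply: mem_set; exact: DE.
  rewrite xE => hfx; rewrite -(@lee_pmul2l _ k%:E)// ?lte_fin//.
  by rewrite -EFinM mulrA divff ?gt_eqF// mul1r (le_trans hfx)// fg//; apply: set_mem.
rewrite lee_fin => hx0.
have -> : h x = 0 by apply/eqP; rewrite eq_le hx0 fun_ge0.
by rewrite mulr0; case: ifPn => // /set_mem; exact: g0.
Qed.

(** The [A i] are disjoint, so the step function with value [c i] on [A i] lies below [h]. It is
    applied with [h = 1] to add up the masses of disjoint balls, and with [h] the p-th power of the
    oscillation. *)
Lemma sum_mule_measure_le_integral n (A : nat -> set T) (c : nat -> R) (E : set T)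
    (h : T -> \bar R) :
  (forall i, (i < n)%N -> measurable (A i) /\ A i `<=` E) ->
  (forall i j x, (i < n)%N -> (j < n)%N -> A i x -> A j x -> i = j) ->
  (forall i, (i < n)%N -> 0 <= c i) ->
  (forall x, E x -> (0 <= h x)%E) ->
  (forall i x, (i < n)%N -> A i x -> ((c i)%:E <= h x)%E) ->
  (\sum_(i < n) (c i)%:E * mu (A i) <= \int[mu]_(x in E) h x)%E.
Proof.
move=> mA dA c0 h0 ch.
pose A' i := if (i < n)%N then A i else set0.
have mA' i : measurable (A' i) by rewrite /A'; case: ifPn => // /mA[].
have -> : (\sum_(i < n) (c i)%:E * mu (A i) =
    \int[mu]_x (\sum_(i < n) (c i)%:E * (\1_(A' i) x)%:E))%E.
  rewrite ge0_integral_sum//.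
  - apply: eq_bigr => i _; rewrite ge0_integralZl_EFin//.
    + by rewrite integral_indic// setIT /A' ltn_ord.
    + exact/measurable_EFinP.
    + exact: c0.
  - by move=> i; apply/measurable_EFinP; apply: measurable_funM.
  - by move=> i x _; rewrite -EFinM lee_fin mulr_ge0// c0.
have -> : (\int[mu]_(x in E) h x = 1%:E * \int[mu]_x (h \_ E) x)%E.
  by rewrite mul1e -integral_mkcond.
have hE0 x : (0 <= (h \_ E) x)%E by exact: erestrict_ge0.
apply: ge0_le_integral_scale => //.
  by move=> x _; apply: sume_ge0 => i _; rewrite -EFinM lee_fin mulr_ge0// c0.
move=> x _; rewrite mul1e.
have [[i ix]|none] := pselect (exists i : 'I_n, A i x).
  rewrite (bigD1 i)//= big1.
    rewrite /A' ltn_ord indicE mem_set// mule1 adde0 patchE mem_set.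
      exact: ch.
    by have [_] := mA _ (ltn_ord i); apply.
  move=> j ji; rewrite /A' ltn_ord indicE memNset ?mule0// => jx.
  by move/eqP : ji; apply; apply/val_inj/(dA j i x).
rewrite big1// => i _; rewrite /A' ltn_ord indicE memNset ?mule0// => ix.
by apply: none; exists i.
Qed.

End lower_integral.

(** * Distances as elements of the real field *)

Section distance.
Context {R : realType} {d : measure_display} {X : metricMeasurableType R d}.
Implicit Types x y : X.

(* [mdist] is valued in a [numDomainType]; [rho] views it in [R] itself, so that
   all distances carry one and the same real field structure. *)
Definition rho x y : R := mdist x y.

Lemma rho_ge0 x y : 0 <= rho x y.
Proof. exact: mdist_ge0. Qed.

Lemma rho_sym x y : rho x y = rho y x.
Proof. exact: metric_sym. Qed.

Lemma rho_triangle x y w : rho x w <= rho x y + rho y w.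
Proof. exact: metric_triangle. Qed.

Lemma ball_rho x (r : R) : ball x r = [set y | rho x y < r].
Proof. exact: ballEmdist. Qed.

End distance.

(** * Volumes of balls under doubling, and separated nets *)

Section ball_volume.
Context {R : realType} {d : measure_display} {X : metricMeasurableType R d}.
Variable mu : {measure set X -> \bar R}.
Hypothesis borelX : borel_compatible X.
Hypothesis mu_ball : balls_positive_finite mu.

Lemma metric_ball_open (x : X) (r : R) : open (ball x r).
Proof.
rewrite openE => y; rewrite ball_rho /= => xy.
apply/nbhs_ballP; exists (r - rho x y) => /=; first by rewrite subr_gt0.
move=> w; rewrite !ball_rho /= => yw.
by rewrite (le_lt_trans (rho_triangle x y w))// -ltrBrDl.
Qed.

Lemma measurable_metric_ball (x : X) (r : R) : measurable (ball x r).
Proof. exact/borelX/metric_ball_open. Qed.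

Lemma metric_ball_sub (x y : X) (r t : R) :
  rho x y + r <= t -> ball y r `<=` ball x t.
Proof.
move=> le_t w; rewrite !ball_rho /= => yw.
by rewrite (le_lt_trans (rho_triangle x y w))// (lt_le_trans _ le_t)// ltrD2l.
Qed.

Definition volume (x : X) (r : R) : R := fine (mu (ball x r)).

Lemma volumeE x r : 0 < r -> mu (ball x r) = (volume x r)%:E.
Proof.
move=> r0; have /andP[m0 mfin] := mu_ball x r0.
by rewrite /volume fineK// ge0_fin_numE// ltW.
Qed.

Lemma volume_gt0 x r : 0 < r -> 0 < volume x r.
Proof.
by move=> r0; have /andP[+ _] := mu_ball x r0; rewrite volumeE// lte_fin.
Qed.

Lemma volume_mono x y r t : 0 < r -> rho x y + r <= t ->
  volume y r <= volume x t.
Proof.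
move=> r0 le_t; have t0 : 0 < t.
  by apply: lt_le_trans le_t; rewrite ltr_wpDl// rho_ge0.
rewrite -lee_fin -!volumeE//; apply: le_measure;
  rewrite ?inE; [exact: measurable_metric_ball..|exact: metric_ball_sub].
Qed.

Section doubling_volume.
Variable D : R.
Hypothesis D0 : 0 <= D.
Hypothesis doubD : doubling mu D.

Lemma volume_doubling_iter k x r : 0 < r -> volume x (2 ^+ k * r) <= D ^+ k * volume x r.
Proof.
move=> r0; elim: k => [|k IH]; first by rewrite !expr0 !mul1r.
have r2 : 0 < 2 ^+ k * r by rewrite mulr_gt0// exprn_gt0.
rewrite !exprS -!mulrA.
apply: le_trans (ler_wpM2l D0 IH).
by rewrite -lee_fin EFinM -!volumeE ?mulr_gt0//; apply: doubD.
Qed.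

Lemma volume_doubling k x y r t : 0 < r -> 0 < t -> rho x y + r <= 2 ^+ k * t ->
  volume y r <= D ^+ k * volume x t.
Proof.
move=> r0 t0 rt; apply: le_trans (volume_doubling_iter k x t0).
exact: volume_mono.
Qed.

End doubling_volume.

(* A bounded set of separated points is finite because the disjoint balls
   around them carry a definite fraction of a finite mass. *)
Lemma finite_separated_net (D : R) (z : X) (s e : R) : 0 <= D -> doubling mu D ->
  0 < e -> e <= s ->
  exists n (x : nat -> X),
    [/\ forall i, (i < n)%N -> rho z (x i) < s,
        forall i j, (i < n)%N -> (j < n)%N -> i <> j -> e <= rho (x i) (x j) &
        forall y, rho z y < s -> exists2 i, (i < n)%N & rho (x i) y < e].
Proof.
move=> D0 doubD e0 es; have s0 : 0 < s := lt_le_trans e0 es.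
pose sep n := exists x : nat -> X, (forall i, (i < n)%N -> rho z (x i) < s) /\
  (forall i j, (i < n)%N -> (j < n)%N -> i <> j -> e <= rho (x i) (x j)).
have sep0 : `[< sep 0%N >] by apply/asboolP; exists (fun=> z).
have e20 : 0 < e / 2 by rewrite divr_gt0.
(* [k] doublings take the radius [e / 2] to at least [3 * s], and the ball of radius [3 * s] about
   [x i] contains [ball z (2 * s)]. *)
have [k Hk] : exists k, 3 * s <= 2 ^+ k * (e / 2).
  have s3 : 0 <= 3 * s / (e / 2) by rewrite divr_ge0// ltW// mulr_gt0.
  exists (Num.bound (3 * s / (e / 2))); rewrite -ler_pdivrMr//.
  by rewrite (le_trans (ltW (archi_boundP s3)))// -natrX ler_nat ltnW// ltn_expl.
(* Packing bound: the balls of radius [e / 2] about the points are disjoint in [ball z (2 * s)] and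
   each carries at least the fraction [1 / D ^+ k] of its volume, so there are at most [D ^+ k] of
   them. *)
have [N HN] : exists N : nat, forall n, `[< sep n >] -> (n <= N)%N.
  exists (Num.bound (D ^+ k)) => n /asboolP[x [xs xe]].
  have Dk0 : 0 <= D ^+ k by rewrite exprn_ge0.
  rewrite -(ler_nat R) (le_trans _ (ltW (archi_boundP Dk0)))//.
  have s20 : 0 < 2 * s by rewrite mulr_gt0.
  have V0 := volume_gt0 z s20.
  rewrite -(ler_pM2r V0).
  have Vi i : (i < n)%N -> volume z (2 * s) <= D ^+ k * volume (x i) (e / 2).
    move=> ltin; apply: volume_doubling => //; apply: le_trans Hk.
    have := xs _ ltin; rewrite rho_sym; lra.
  have sumV : \sum_(i < n) volume (x i) (e / 2) <= volume z (2 * s).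
    have := @sum_mule_measure_le_integral _ _ _ mu n (fun i => ball (x i) (e / 2))
      (fun=> 1) (ball z (2 * s)) (cst 1%E).
    rewrite integral_cst ?mul1e; last exact: measurable_metric_ball.
    rewrite volumeE// => H; rewrite -lee_fin -sumEFin; apply: le_trans (H _ _ _ _ _) => //.
    - by rewrite le_eqVlt; apply/orP; left; apply/eqP; apply: eq_bigr => i _; rewrite mul1e volumeE.
    - move=> i ltin; split; first exact: measurable_metric_ball.
      by apply: metric_ball_sub; have := xs _ ltin; lra.
    - move=> i j w lti ltj; rewrite !ball_rho /= => iw jw.
      apply: contrapT => ij; have := xe _ _ lti ltj ij.
      by have := rho_triangle (x i) w (x j); rewrite (rho_sym w); lra.
  apply: le_trans (ler_wpM2l Dk0 sumV).
  rewrite mulr_sumr; apply: (@le_trans _ _ (\sum_(i < n) volume z (2 * s))).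
    by rewrite sumr_const card_ord mulr_natl.
  by apply: ler_sum => i _; exact: Vi.
have [n /asboolP[x [xs xe]] nmax] := ex_maxnP (ex_intro (fun n => is_true `[< sep n >]) _ sep0) HN.
(* A separated family of maximal size covers: a point [y] at distance at least [e] from every [x i]
   could be added to it. *)
exists n, x; split => // y zy; apply: contrapT => none.
have /nmax : `[< sep n.+1 >]; last by rewrite ltnn.
apply/asboolP; exists (fun i => if (i < n)%N then x i else y); split.
  by move=> i _; case: ifPn => // /xs.
have far i : (i < n)%N -> e <= rho (x i) y.
  by move=> ltin; rewrite leNgt; apply/negP => ?; apply: none; exists i.
move=> i j; rewrite !ltnS => lei lej ij; case: ifPn => [ltin|nlti].
  by case: ifPn => [ltjn|_]; [exact: xe|exact: far].
case: ifPn => [ltjn|nltj]; first by rewrite rho_sym; exact: far.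
exfalso; apply: ij; apply/eqP; rewrite eqn_leq.
move: nlti nltj; rewrite -!leqNgt => ni nj.
by rewrite (leq_trans lei nj) (leq_trans lej ni).
Qed.

End ball_volume.

(** * Integrals against bounded multipliers *)

Section bounded_multiplier.
Context {R : realType} {d : measure_display} {T : measurableType d}.
Variable mu : {measure set T -> \bar R}.

Lemma Rintegral_support (B : set T) (g : T -> R) :
  (forall y, ~ B y -> g y = 0) -> \int[mu]_y g y = \int[mu]_(y in B) g y.
Proof.
move=> g0; rewrite [RHS]Rintegral_mkcond; congr (Rintegral _ _ _).
by apply/funext => y; rewrite patchE; case: ifPn => // /negP; rewrite inE => /g0.
Qed.

Lemma integrable_bounded_mul (B : set T) (h g : T -> R) (a : R) :
  measurable B -> measurable_fun setT h -> (forall y, B y -> `|h y| <= a) ->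
  mu.-integrable B (EFin \o g) ->
  mu.-integrable B (EFin \o (fun y => h y * g y)).
Proof.
move=> mB mh ha ig.
have := integrableZl mB a ig; apply: le_integrable => //.
  apply/measurable_EFinP; apply: measurable_funM.
    exact: measurable_funS mh.
  by apply/measurable_EFinP; exact: measurable_int ig.
move=> y By /=; rewrite lee_fin !normrM ler_wpM2r//.
by rewrite (le_trans (ha _ By))// ler_norm.
Qed.

Lemma integrable_dist_cst (B : set T) (g : T -> R) (c : R) :
  measurable B -> (mu B < +oo)%E -> mu.-integrable B (EFin \o g) ->
  mu.-integrable B (EFin \o (fun y => g y - c)).
Proof.
move=> mB Bfin ig.
have ic : mu.-integrable B (EFin \o cst c).
  by apply: measurable_bounded_integrable => //; exact: bounded_cst.
have := integrableB mB ig ic; apply: eq_integrable => // y _ /=.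
Qed.

Lemma Rintegral_bounded_mul_le (B : set T) (h g : T -> R) (a : R) :
  measurable B -> measurable_fun setT h -> (forall y, B y -> `|h y| <= a) ->
  mu.-integrable B (EFin \o g) ->
  `|\int[mu]_(y in B) (h y * g y)| <= a * \int[mu]_(y in B) `|g y|.
Proof.
move=> mB mh ha ig.
have ihg := integrable_bounded_mul mB mh ha ig.
apply: le_trans (le_normr_Rintegral mB ihg) _.
rewrite -RintegralZl//; last exact: integrable_norm ig.
apply: le_Rintegral => //.
- exact: integrable_norm ihg.
- have := integrableZl mB a (integrable_norm ig); apply: eq_integrable => //.
- by move=> y By; rewrite normrM ler_wpM2r// ha.
Qed.

End bounded_multiplier.

(** * Mean oscillation on balls as a real number *)

Section oscillation.
Context {R : realType} {d : measure_display} {X : metricMeasurableType R d}.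
Variable mu : {measure set X -> \bar R}.
Hypothesis borelX : borel_compatible X.
Hypothesis mu_ball : balls_positive_finite mu.

(** Since [fine] sends infinite values to 0, this agrees with [mean_osc] only under integrability on
    the ball, as in [mean_oscE]. *)
Definition osc (f : X -> R) (x : X) (r : R) : R := fine (mean_osc mu f x r).

Let mB := measurable_metric_ball borelX.

Lemma ball_fin x r : 0 < r -> (mu (ball x r) < +oo)%E.
Proof. by move=> r0; rewrite volumeE// ltry. Qed.

Lemma average_ballE (g : X -> R) x r : 0 < r ->
  mu.-integrable (ball x r) (EFin \o g) ->
  average mu (ball x r) (fun y => (g y)%:E) =
  ((volume mu x r)^-1 * \int[mu]_(y in ball x r) g y)%:E.
Proof.
move=> r0 ig; rewrite /average volumeE// inver gt_eqF ?volume_gt0//.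
by rewrite EFinM /Rintegral fineK//; exact: integrable_fin_num.
Qed.

Section integrable_on_ball.
Variables (f : X -> R) (x : X) (r : R).
Hypothesis r0 : 0 < r.
Hypothesis intf : mu.-integrable (ball x r) (EFin \o f).

Lemma integrable_norm_dist c :
  mu.-integrable (ball x r) (EFin \o (fun y => `|f y - c|)).
Proof. exact/integrable_norm/integrable_dist_cst/intf/ball_fin. Qed.

Lemma mean_ballE :
  volume mu x r * mean mu f (ball x r) = \int[mu]_(y in ball x r) f y.
Proof.
by rewrite /mean (average_ballE r0 intf)/= mulrA divff ?mul1r// gt_eqF// volume_gt0.
Qed.

Lemma mean_oscE : mean_osc mu f x r = (osc f x r)%:E.
Proof.
by rewrite /osc /mean_osc average_ballE//; exact: integrable_norm_dist.
Qed.

Lemma osc_integral : volume mu x r * osc f x r =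
  \int[mu]_(y in ball x r) `|f y - mean mu f (ball x r)|.
Proof.
rewrite /osc /mean_osc average_ballE//=; last exact: integrable_norm_dist.
by rewrite mulrA divff ?mul1r// gt_eqF// volume_gt0.
Qed.

Lemma osc_ge0 : 0 <= osc f x r.
Proof.
rewrite -(pmulr_rge0 _ (volume_gt0 mu_ball x r0)) osc_integral.
exact: Rintegral_ge0.
Qed.

Lemma mean_dist_le (g : X -> R) : mu.-integrable (ball x r) (EFin \o g) ->
  volume mu x r * `|mean mu f (ball x r) - mean mu g (ball x r)| <=
  \int[mu]_(y in ball x r) `|f y - g y|.
Proof.
move=> intg; have V0 := volume_gt0 mu_ball x r0.
rewrite -{1}(gtr0_norm V0) -normrM mulrBr mean_ballE.
have -> : volume mu x r * mean mu g (ball x r) = \int[mu]_(y in ball x r) g y.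
  by rewrite /mean (average_ballE r0 intg)/= mulrA divff ?mul1r// gt_eqF.
rewrite -RintegralB//; apply: le_normr_Rintegral => //.
by have := integrableB (mB x r) intf intg; apply: eq_integrable.
Qed.

Lemma integrable_cst_ball c : mu.-integrable (ball x r) (EFin \o cst c).
Proof.
by apply: measurable_bounded_integrable => //; [exact: ball_fin|exact: bounded_cst].
Qed.

Lemma mean_cst c : mean mu (cst c) (ball x r) = c.
Proof.
have V0 := volume_gt0 mu_ball x r0.
rewrite /mean (average_ballE r0 (integrable_cst_ball c))/= Rintegral_cst//.
by rewrite mulrCA mulVf ?mulr1// gt_eqF.
Qed.

(** With [a] and [b] the two means, [|f - a| <= |g - b| + |a - b| + |f - g|]. The integral of the
    constant [|a - b|] costs a second integral of [|f - g|], hence the factor 2. *)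
Lemma osc_le_add (g : X -> R) : mu.-integrable (ball x r) (EFin \o g) ->
  volume mu x r * osc f x r <=
  \int[mu]_(y in ball x r) `|g y - mean mu g (ball x r)| +
  2 * \int[mu]_(y in ball x r) `|f y - g y|.
Proof.
move=> intg; have V0 := volume_gt0 mu_ball x r0.
rewrite osc_integral mulr_natl mulr2n.
set a := mean mu f _; set b := mean mu g _.
have ig : mu.-integrable (ball x r) (EFin \o (fun y => `|g y - b|)).
  exact/integrable_norm/integrable_dist_cst/intg/ball_fin.
have ifg : mu.-integrable (ball x r) (EFin \o (fun y => `|f y - g y|)).
  apply: integrable_norm.
  by have := integrableB (mB x r) intf intg; apply: eq_integrable.
have ic := integrable_cst_ball `|a - b|.
have igc : mu.-integrable (ball x r) (EFin \o (fun y => `|g y - b| + `|a - b|)).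
  by have := integrableD (mB x r) ig ic; apply: eq_integrable.
rewrite addrA; apply: le_trans (lerD (lexx _) (mean_dist_le intg)).
rewrite mulrC -Rintegral_cst// addrAC.
rewrite -RintegralD// -RintegralD//; apply: le_Rintegral => //.
- exact: integrable_norm_dist.
- by have := integrableD (mB x r) igc ifg; apply: eq_integrable.
- move=> y _; have := ler_normD (f y - g y) (g y - b).
  have := ler_normD (f y - b) (b - a).
  by rewrite !addrA !subrK distrC (distrC b a); lra.
Qed.

(** The case of a constant [g]: up to the factor 2, the mean is the best constant. *)
Lemma osc_le c :
  volume mu x r * osc f x r <= 2 * \int[mu]_(y in ball x r) `|f y - c|.
Proof.
apply: le_trans (osc_le_add (integrable_cst_ball c)) _.
under eq_Rintegral do rewrite mean_cst subrr normr0.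
by rewrite Rintegral_cst// mul0r add0r.
Qed.

End integrable_on_ball.

End oscillation.

(** * The tent kernel and the smoothed function *)

Section smoothing.
Context {R : realType} {d : measure_display} {X : metricMeasurableType R d}.
Variable mu : {measure set X -> \bar R}.
Hypothesis borelX : borel_compatible X.
Hypothesis mu_ball : balls_positive_finite mu.

Let mB := measurable_metric_ball borelX.

(** Preimages of open upper rays are open, and the sigma-algebra contains the open sets. *)
Lemma lipschitz_measurable (f : X -> R) : lipschitz_fun f ->
  measurable_fun setT f.
Proof.
move=> [L fL]; apply: (measurability _ (RGenOInfty.measurableE R)) => //.
move=> _ [_ [a ->] <-]; rewrite setTI; apply: borelX; rewrite openE => y /=.
rewrite in_itv /= andbT => ay.
(* [L] may be zero or negative; [|L| + 1] is a positive Lipschitz constant by which one can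
   divide. *)
have L0 : 0 < `|L| + 1 by rewrite ltr_wpDl.
apply/nbhs_ballP; exists ((f y - a) / (`|L| + 1)) => /=.
  by rewrite divr_gt0// subr_gt0.
move=> w; rewrite ball_rho /= in_itv /= andbT => yw.
have : (`|L| + 1) * rho y w < f y - a by rewrite mulrC -ltr_pdivlMr.
have : f y - f w <= L * rho y w by apply: le_trans (ler_norm _) (fL _ _).
have := ler_wpM2r (rho_ge0 y w) (ler_norm L); have := rho_ge0 y w.
lra.
Qed.

Variable delta : R.
Hypothesis delta0 : 0 < delta.

Definition tent (x y : X) : R := Num.max 0 (1 - rho x y / delta).

Lemma tent_ge0 x y : 0 <= tent x y.
Proof. by rewrite /tent le_max lexx. Qed.

Lemma tent_le1 x y : tent x y <= 1.
Proof.
by rewrite /tent ge_max ler01 lerBlDr lerDl divr_ge0 ?rho_ge0// ltW.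
Qed.

Lemma tent_out x y : delta <= rho x y -> tent x y = 0.
Proof.
by move=> xy; rewrite /tent max_l// subr_le0 ler_pdivlMr// mul1r.
Qed.

Lemma tent_ge_half x y : rho x y < delta / 2 -> 2^-1 <= tent x y.
Proof.
move=> xy; rewrite /tent le_max; apply/orP; right.
by rewrite lerBrDl -lerBrDr ler_pdivrMr//; lra.
Qed.

Lemma tent_lip x x' y : `|tent x y - tent x' y| <= rho x x' / delta.
Proof.
have h : `|rho x y / delta - rho x' y / delta| <= rho x x' / delta.
  rewrite -mulrBl normrM (gtr0_norm (_ : 0 < delta^-1)) ?invr_gt0//.
  apply: ler_wpM2r; first by rewrite invr_ge0 ltW.
  rewrite ler_norml.
  have := rho_triangle x x' y; have := rho_triangle x' x y.
  by rewrite (rho_sym x' x) => ? ?; apply/andP; split; lra.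
apply: le_trans h; rewrite /tent.
set a := rho x y / _; set b := rho x' y / _.
have m (x0 : R) : Num.max 0 (1 - x0) = 0 /\ 1 <= x0 \/ Num.max 0 (1 - x0) = 1 - x0 /\ x0 <= 1.
  have [x1|x1] := leP x0 1; [right|left]; split => //.
  - by rewrite max_r// subr_ge0.
  - by rewrite max_l// subr_le0 ltW.
  - exact: ltW.
have h1 := ler_norm (a - b); have h2 := ler_norm (b - a); have h3 := normr_ge0 (a - b).
rewrite distrC in h2.
by case: (m a) => -[-> ?]; case: (m b) => -[-> ?]; rewrite ler_norml;
  apply/andP; split; lra.
Qed.

Lemma tent_sym x y : tent x y = tent y x.
Proof. by rewrite /tent rho_sym. Qed.

Lemma measurable_tent x : measurable_fun setT (tent x).
Proof.
apply: lipschitz_measurable; exists delta^-1 => y y'.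
by rewrite !(tent_sym x) mulrC; exact: tent_lip.
Qed.

Definition weight (x : X) : R := \int[mu]_y tent x y.

Definition kern (x y : X) : R := tent x y / weight x.

Definition smooth (f : X -> R) (x : X) : R := \int[mu]_y (kern x y * f y).

Section kernel_bounds.
Variable D : R.
Hypothesis D1 : 1 <= D.
Hypothesis doubD : doubling mu D.

(** With [V] the volume of [ball u (4 * delta)], the quotient [a / V] bounds both the reciprocal of
    the weight and the kernel near [u]. *)
Let a : R := 2 * D ^+ 4.

Let a0 : 0 < a. Proof. by rewrite mulr_gt0// exprn_gt0// (lt_le_trans _ D1). Qed.

Section near_point.
Variable u : X.
Let B := ball u (4 * delta).
Let V := volume mu u (4 * delta).

Let r0 : 0 < 4 * delta. Proof. by rewrite mulr_gt0. Qed.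

Let V0 : 0 < V. Proof. exact: volume_gt0. Qed.

(** The radius is the sum of the radius [delta] of the covering balls and the radius [delta / 2] of
    the disjoint ones. For such [x] the ball of radius [delta] about [x] stays inside [B]. *)
Let near (x : X) := rho u x <= 3 / 2 * delta.

Lemma tent_support x (y : X) : near x -> ~ B y -> tent x y = 0.
Proof.
move=> ux yB; apply: tent_out.
have uy : 4 * delta <= rho u y.
  by rewrite leNgt; apply/negP => uy; apply: yB; rewrite /B ball_rho.
by have := rho_triangle u x y; have := delta0; move: ux; rewrite /near; lra.
Qed.

Lemma integrable_tent x : mu.-integrable B (EFin \o tent x).
Proof.
apply: measurable_bounded_integrable => //; [exact: mB|exact: ball_fin| |].
  by apply: measurable_funS (measurable_tent x).
exists 1; split => // M M1 y _ /=.
by rewrite ger0_norm ?tent_ge0// (le_trans (tent_le1 _ _))// ltW.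
Qed.

Lemma weightE x : near x -> weight x = \int[mu]_(y in B) tent x y.
Proof. by move=> ux; apply: Rintegral_support => y; exact: tent_support. Qed.

(** The tent is at least 1/2 on [ball x (delta / 2)], and four doublings of that ball give one that
    contains [B]. *)
Lemma weight_ge x : near x -> V / a <= weight x.
Proof.
move=> ux; have D0 : 0 <= D := le_trans ler01 D1.
have d20 : 0 < delta / 2 by rewrite divr_gt0.
have VD : V <= D ^+ 4 * volume mu x (delta / 2).
  apply: (volume_doubling borelX mu_ball D0 doubD) => //.
  have -> : 2 ^+ 4 = 16 :> R by ring.
  by rewrite rho_sym; move: ux; have := delta0; rewrite /near; lra.
apply: (@le_trans _ _ (2^-1 * volume mu x (delta / 2))).
  rewrite ler_pdivrMr//.
  by apply: le_trans VD _; rewrite le_eqVlt; apply/orP; left; apply/eqP; rewrite /a; field.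
rewrite -lee_fin (weightE ux) /Rintegral fineK; last first.
  by apply: integrable_fin_num; [exact: mB|exact: integrable_tent].
rewrite EFinM -volumeE// -(integral_cst mu (mB x _)) -[leRHS]mul1e.
apply: ge0_le_integral_scale => //.
- apply: metric_ball_sub; move: ux; have := delta0; rewrite /near; lra.
- by move=> y _; rewrite lee_fin.
- by move=> y _; rewrite lee_fin tent_ge0.
- by move=> y; rewrite mul1e ball_rho /= lee_fin; exact: tent_ge_half.
Qed.

Lemma weight_gt0 x : near x -> 0 < weight x.
Proof.
move=> ux; apply: lt_le_trans (weight_ge ux).
by rewrite divr_gt0.
Qed.

(** Both tents vanish off [B], so [tent_lip] is integrated over [B] only. *)
Lemma weight_lip x x' : near x -> near x' ->
  `|weight x - weight x'| <= rho x x' / delta * V.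
Proof.
move=> ux ux'; rewrite !weightE// -RintegralB//; last 3 first.
- exact: mB.
- exact: integrable_tent.
- exact: integrable_tent.
have it : mu.-integrable B (EFin \o (fun y => tent x y - tent x' y)).
  have := integrableB (mB _ _) (integrable_tent x) (integrable_tent x').
  by apply: eq_integrable => //; exact: mB.
apply: le_trans (le_normr_Rintegral _ it) _; first exact: mB.
rewrite -Rintegral_cst; last exact: mB.
apply: le_Rintegral; [exact: mB|exact: integrable_norm it| |].
  exact: integrable_cst_ball.
by move=> y _; exact: tent_lip.
Qed.

Lemma weight_inv_le x : near x -> (weight x)^-1 <= a / V.
Proof.
move=> ux; rewrite -[leRHS]invrK invf_div lef_pV2 ?posrE ?weight_gt0//.
  exact: weight_ge.
by rewrite divr_gt0.
Qed.

Lemma kern_bound x y : near x -> `|kern x y| <= a / V.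
Proof.
move=> ux; rewrite /kern normrM (ger0_norm (tent_ge0 _ _)) gtr0_norm ?invr_gt0 ?weight_gt0//.
rewrite -[leRHS]mul1r; apply: ler_pM; [exact: tent_ge0| |exact: tent_le1|exact: weight_inv_le].
by rewrite invr_ge0 ltW// weight_gt0.
Qed.

(** Quotient rule: with [t = rho x x' / delta], the tent varies by at most [t], the weight by at
    most [t * V], and reciprocals of weights are at most [a / V]. *)
Lemma kern_lip x x' y : near x -> near x' ->
  `|kern x y - kern x' y| <= (a + a ^+ 2) * (rho x x' / delta) / V.
Proof.
move=> ux ux'; set t := rho x x' / delta.
have w0 := weight_gt0 ux; have w0' := weight_gt0 ux'.
have -> : kern x y - kern x' y = (tent x y - tent x' y) * (weight x)^-1 +
    tent x' y * ((weight x' - weight x) * ((weight x)^-1 * (weight x')^-1)).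
  by rewrite /kern; field; rewrite !gt_eqF.
have t0 : 0 <= t by rewrite divr_ge0 ?rho_ge0 ?ltW.
have -> : (a + a ^+ 2) * t / V = t * (a / V) + 1 * (t * V * (a / V * (a / V))).
  by field; rewrite gt_eqF.
apply: le_trans (ler_normD _ _) _; apply: lerD.
  rewrite normrM; apply: ler_pM => //; first exact: tent_lip.
  by rewrite gtr0_norm ?invr_gt0//; exact: weight_inv_le.
rewrite normrM; apply: ler_pM => //.
  by rewrite ger0_norm ?tent_ge0 ?tent_le1.
rewrite normrM; apply: ler_pM => //.
  by rewrite distrC; exact: weight_lip.
rewrite gtr0_norm ?mulr_gt0 ?invr_gt0//.
by apply: ler_pM; rewrite ?invr_ge0 ?(ltW w0) ?(ltW w0')//; exact: weight_inv_le.
Qed.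

Lemma measurable_kern x : measurable_fun setT (kern x).
Proof. by apply: measurable_funM => //; exact: measurable_tent. Qed.

Lemma integral_kern x : near x -> \int[mu]_(y in B) kern x y = 1.
Proof.
move=> ux; rewrite RintegralZr; [|exact: mB|exact: integrable_tent].
by rewrite -weightE// divff// gt_eqF// weight_gt0.
Qed.

Section smooth_bounds.
Variable f : X -> R.
Hypothesis intf : mu.-integrable B (EFin \o f).

Lemma integrable_kern_mul g x : near x -> mu.-integrable B (EFin \o g) ->
  mu.-integrable B (EFin \o (fun y => kern x y * g y)).
Proof.
move=> ux; apply: (@integrable_bounded_mul _ _ _ _ _ _ _ (a / V)).
- exact: mB.
- exact: measurable_kern.
- by move=> y _; exact: kern_bound.
Qed.

(** The kernel has mass 1 on [B], so a constant may be moved under the integral. *)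
Lemma smooth_sub_cst x c : near x ->
  smooth f x - c = \int[mu]_(y in B) (kern x y * (f y - c)).
Proof.
move=> ux; rewrite /smooth (@Rintegral_support _ _ _ _ B); last first.
  by move=> y By; rewrite /kern (tent_support ux By) !mul0r.
rewrite -{1}[c]mul1r -(integral_kern ux) -RintegralZr; last 2 first.
- exact: mB.
- have := integrable_kern_mul ux (integrable_cst_ball borelX mu_ball u r0 1).
  by apply: eq_integrable => [|y _ /=]; [exact: mB|rewrite mulr1].
rewrite -RintegralB; last 3 first.
- exact: mB.
- exact: integrable_kern_mul.
- exact: (integrable_kern_mul ux (integrable_cst_ball borelX mu_ball u r0 c)).
by apply: eq_Rintegral => y _; rewrite mulrBr.
Qed.

Lemma smooth_dist_mean x : near x ->
  `|smooth f x - mean mu f B| <= a * osc mu f u (4 * delta).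
Proof.
move=> ux; rewrite smooth_sub_cst//.
apply: le_trans (Rintegral_bounded_mul_le (a := a / V) _ _ _ _) _.
- exact: mB.
- exact: measurable_kern.
- by move=> y _; exact: kern_bound.
- by apply: integrable_dist_cst => //; [exact: mB|exact: ball_fin].
by rewrite -osc_integral// mulrA divfK// gt_eqF.
Qed.

(** Subtracting the same mean [m] at both points leaves the integral of
    [(kern x - kern x') * (f - m)], and the integral of [|f - m|] over [B] is [V] times the
    oscillation at [u]. *)
Lemma smooth_lip x x' : near x -> near x' ->
  `|smooth f x - smooth f x'| <=
  (a + a ^+ 2) * (rho x x' / delta) * osc mu f u (4 * delta).
Proof.
move=> ux ux'; set m := mean mu f B.
have im : mu.-integrable B (EFin \o (fun y => f y - m)).
  by apply: integrable_dist_cst => //; [exact: mB|exact: ball_fin].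
have -> : smooth f x - smooth f x' =
    \int[mu]_(y in B) ((kern x y - kern x' y) * (f y - m)).
  have -> : smooth f x - smooth f x' = (smooth f x - m) - (smooth f x' - m).
    by rewrite opprB addrA subrK.
  rewrite (smooth_sub_cst m ux) (smooth_sub_cst m ux') -RintegralB; last 3 first.
  - exact: mB.
  - exact: integrable_kern_mul.
  - exact: integrable_kern_mul.
  by apply: eq_Rintegral => y _; rewrite mulrBl.
apply: le_trans (Rintegral_bounded_mul_le
  (a := (a + a ^+ 2) * (rho x x' / delta) / V) _ _ _ im) _.
- exact: mB.
- by apply: measurable_funB; exact: measurable_kern.
- by move=> y _; exact: kern_lip.
by rewrite -osc_integral// mulrA divfK// gt_eqF.
Qed.

End smooth_bounds.

End near_point.

End kernel_bounds.

End smoothing.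

(** * Bounds for the pointwise Lipschitz constant *)

Section pointwise_lipschitz_constant.
Context {R : realType} {d : measure_display} {X : metricMeasurableType R d}.

Lemma lip_ge0 (g : X -> R) x : (0 <= lip g x)%E.
Proof.
rewrite /lip limf_einfE.
apply: le_trans (ereal_sup_ubound _); last first.
  by exists [set t | 0 < t]; [exact: nbhs_right_gt|reflexivity].
apply: le_ereal_inf_tmp => _ [t /= t0 <-].
apply: ereal_sup_ubound; exists x; last by rewrite subrr normr0 mul0r.
by rewrite /= mdistxx ltW.
Qed.

(** For [t <= e] and [rho x y <= t] the quotient by [t] is at most [K], and the lower limit at 0
    only sees such [t]. *)
Lemma lip_le (g : X -> R) x (e K : R) : 0 < e -> 0 <= K ->
  (forall y, rho x y <= e -> `|g x - g y| <= K * rho x y) ->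
  (lip g x <= K%:E)%E.
Proof.
move=> e0 K0 gK; rewrite /lip limf_einfE; apply: ge_ereal_sup => _ [V V0 <-].
(* The lower limit is a supremum over neighbourhoods [V] of infima over [V], so one good [t] in each
   [V] is enough. *)
have [t [Vt [t0 te]]] : exists t, V t /\ 0 < t /\ t <= e.
  have V0e : nbhs 0^'+ (V `&` ([set t | 0 < t] `&` [set t | t <= e])).
    by apply: filterI => //; apply: filterI; [exact: nbhs_right_gt|exact: nbhs_right_le].
  by have [t [? []]] := filter_ex V0e; exists t.
apply: (@le_trans _ _ (ereal_sup
    [set (`|g x - g y| / t)%:E | y in [set y : X | (mdist x y <= t)%R]])).
  by apply: ereal_inf_lbound; exists t.
apply: ge_ereal_sup => _ [y /= xy <-]; rewrite lee_fin ler_pdivrMr//.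
have xyt : rho x y <= t by [].
by apply: le_trans (gK _ (le_trans xyt te)) _; exact: ler_wpM2l.
Qed.

End pointwise_lipschitz_constant.

(** * Smoothing a bounded function *)

Section bounded_function.
Context {R : realType} {d : measure_display} {X : metricMeasurableType R d}.
Variable mu : {measure set X -> \bar R}.
Hypothesis borelX : borel_compatible X.
Hypothesis mu_ball : balls_positive_finite mu.
Variables (delta D : R).
Hypothesis delta0 : 0 < delta.
Hypothesis D1 : 1 <= D.
Hypothesis doubD : doubling mu D.
Variables (f : X -> R) (M : R).
Hypothesis mf : measurable_fun setT f.
Hypothesis fM : forall x, `|f x| <= M.

Let mB := measurable_metric_ball borelX.
Let a : R := 2 * D ^+ 4.
Let a0 : 0 < a. Proof. by rewrite mulr_gt0// exprn_gt0// (lt_le_trans _ D1). Qed.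
Let r0 : 0 < 4 * delta. Proof. by rewrite mulr_gt0. Qed.
Let near_refl (x : X) : rho x x <= 3 / 2 * delta.
Proof. by rewrite /rho mdistxx mulr_ge0// ltW. Qed.

Lemma bounded_integrable_ball x r : 0 < r ->
  mu.-integrable (ball x r) (EFin \o f).
Proof.
move=> r1; apply: measurable_bounded_integrable;
  [exact: mB|exact: ball_fin|exact: measurable_funS mf|].
exists M; split=> [|N MN y _] /=; first exact: num_real.
by rewrite (le_trans (fM y))// ltW.
Qed.

Let M0 (x : X) : 0 <= M. Proof. exact: le_trans (fM x). Qed.

Lemma integral_norm_le_bound x r : 0 < r ->
  \int[mu]_(y in ball x r) `|f y| <= M * volume mu x r.
Proof.
move=> r1; rewrite -Rintegral_cst; last exact: mB.
apply: le_Rintegral; [exact: mB| | |by []].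
- exact: (integrable_norm (bounded_integrable_ball x r1)).
- exact: integrable_cst_ball.
Qed.

Lemma osc_le_bound x r : 0 < r -> osc mu f x r <= 2 * M.
Proof.
move=> r1; rewrite -(ler_pM2l (volume_gt0 mu_ball x r1)).
have := osc_le borelX mu_ball r1 (bounded_integrable_ball x r1) 0.
under eq_Rintegral do rewrite subr0.
have := integral_norm_le_bound x r1; lra.
Qed.

Lemma smooth_le_bound x : `|smooth mu delta f x| <= a * M.
Proof.
have if1 := bounded_integrable_ball x r0.
have := smooth_sub_cst borelX mu_ball delta0 D1 doubD if1 0 (near_refl x).
rewrite subr0 => ->.
have V0 := volume_gt0 mu_ball x r0.
apply: le_trans (Rintegral_bounded_mul_le
  (a := a / volume mu x (4 * delta)) _ _ _ _) _.
- exact: mB.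
- exact: measurable_kern.
- by move=> y _; apply: (kern_bound borelX mu_ball delta0 D1 doubD).
- by move: if1; apply: eq_integrable; [exact: mB|move=> y _ /=; rewrite subr0].
under eq_Rintegral do rewrite subr0.
apply: le_trans (ler_wpM2l _ (integral_norm_le_bound x r0)) _.
  by rewrite divr_ge0// ltW.
by rewrite mulrCA divfK ?gt_eqF// mulrC.
Qed.

Lemma smooth_lip_near (x y : X) : rho x y <= delta ->
  `|smooth mu delta f x - smooth mu delta f y| <=
  (a + a ^+ 2) / delta * osc mu f x (4 * delta) * rho x y.
Proof.
move=> xy; have xy' : rho x y <= 3 / 2 * delta by have := delta0; lra.
have := smooth_lip borelX mu_ball delta0 D1 doubD
  (bounded_integrable_ball x r0) (near_refl x) xy'.
by move=> /le_trans; apply; rewrite le_eqVlt; apply/orP; left; apply/eqP; rewrite /a; ring.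
Qed.

(** Up to distance [delta] the local bound applies, with oscillation at most [2 * M]. Farther apart,
    the values differ by at most [2 * (a * M)] while [rho x y / delta] exceeds 1. *)
Lemma smooth_lipschitz : lipschitz_fun (smooth mu delta f).
Proof.
exists ((a + a ^+ 2) / delta * (2 * M)) => x y.
have aa0 : 0 <= (a + a ^+ 2) / delta.
  by rewrite divr_ge0// ?(ltW delta0)// addr_ge0 ?exprn_ge0// ltW.
have [xy|xy] := leP (rho x y) delta.
  apply: le_trans (smooth_lip_near xy) _; apply: ler_wpM2r; first exact: rho_ge0.
  by apply: ler_wpM2l => //; exact: osc_le_bound.
apply: (@le_trans _ _ (2 * (a * M))).
  apply: le_trans (ler_normB _ _) _; rewrite mulr_natl mulr2n.
  exact: lerD (smooth_le_bound x) (smooth_le_bound y).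
rewrite -/(rho x y).
have -> : (a + a ^+ 2) / delta * (2 * M) * rho x y =
    (2 * (a * M)) * ((1 + a) * (rho x y / delta)).
  by field; rewrite gt_eqF.
have aM : 0 <= 2 * (a * M).
  by rewrite mulr_ge0// mulr_ge0 ?(M0 x)// ltW.
rewrite ler_peMr//; apply: mulr_ege1; first by have := a0; lra.
by rewrite ler_pdivlMr// mul1r ltW.
Qed.

Lemma lip_smooth_le x :
  (lip (smooth mu delta f) x <=
   ((a + a ^+ 2) / delta * osc mu f x (4 * delta))%:E)%E.
Proof.
apply: (@lip_le _ _ _ _ _ delta) => //; last by move=> y; exact: smooth_lip_near.
rewrite mulr_ge0 ?osc_ge0//; last exact: bounded_integrable_ball.
by rewrite divr_ge0// ?(ltW delta0)// addr_ge0 ?exprn_ge0// ltW.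
Qed.

Lemma measurable_smooth : measurable_fun setT (smooth mu delta f).
Proof. exact/lipschitz_measurable/smooth_lipschitz. Qed.

Lemma integrable_smooth x r : 0 < r ->
  mu.-integrable (ball x r) (EFin \o smooth mu delta f).
Proof.
move=> r1; apply: measurable_bounded_integrable;
  [exact: mB|exact: ball_fin|exact: measurable_funS measurable_smooth|].
exists (a * M); split=> [|N MN y _] /=; first exact: num_real.
by rewrite (le_trans (smooth_le_bound y))// ltW.
Qed.

Lemma integrable_sub_smooth x r : 0 < r ->
  mu.-integrable (ball x r) (EFin \o (fun y => `|f y - smooth mu delta f y|)).
Proof.
move=> r1; apply: integrable_norm.
have := integrableB (mB x r) (bounded_integrable_ball x r1) (integrable_smooth x r1).
by apply: eq_integrable => //; exact: mB.
Qed.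

(** The integral does not involve [u], so it yields one constant below the oscillation at all points
    of the half ball. With [m] the mean about [u], the part [|f - m|] is integrated over the larger
    ball about [u] and contributes [D ^+ 4]; the distance from [m] to the smoothed function
    contributes [a * D]. *)
Lemma smooth_approx_local (x u : X) : rho x u < delta / 2 ->
  \int[mu]_(y in ball x delta) `|f y - smooth mu delta f y| <=
  (D ^+ 4 + a * D) * volume mu x (delta / 2) * osc mu f u (4 * delta).
Proof.
move=> xu; set m := mean mu f (ball u (4 * delta)).
set o := osc mu f u (4 * delta).
have D0 : 0 <= D := le_trans ler01 D1.
have d20 : 0 < delta / 2 by rewrite divr_gt0.
have sub : ball x delta `<=` ball u (4 * delta).
  by apply: metric_ball_sub; rewrite rho_sym; have := delta0; lra.
have o0 : 0 <= o by apply: osc_ge0 => //; exact: bounded_integrable_ball.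
have im : mu.-integrable (ball u (4 * delta)) (EFin \o (fun y => `|f y - m|)).
  by apply: integrable_norm_dist => //; exact: bounded_integrable_ball.
have imx : mu.-integrable (ball x delta) (EFin \o (fun y => `|f y - m|)).
  exact: (integrableS (mB _ _) (mB _ _) sub im).
have ic := integrable_cst_ball borelX mu_ball x delta0 (a * o).
apply: (@le_trans _ _ (\int[mu]_(y in ball x delta) (`|f y - m| + a * o))).
  apply: le_Rintegral; [exact: mB|exact: integrable_sub_smooth| |].
    have := integrableD (mB x delta) imx ic.
    by apply: eq_integrable => //; exact: mB.
  move=> y; rewrite ball_rho /= => xy.
  have uy : rho u y <= 3 / 2 * delta.
    by have := rho_triangle u x y; rewrite (rho_sym u x); lra.
  have := smooth_dist_mean borelX mu_ball delta0 D1 doubD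
    (bounded_integrable_ball u r0) uy.
  rewrite -/m -/o -/a => h; have := ler_normD (f y - m) (m - smooth mu delta f y).
  by rewrite addrA subrK (distrC m); lra.
rewrite RintegralD; [|exact: mB|exact: imx|exact: ic].
rewrite Rintegral_cst; last exact: mB.
have h1 : \int[mu]_(y in ball x delta) `|f y - m| <= volume mu u (4 * delta) * o.
  rewrite osc_integral//; last exact: bounded_integrable_ball.
  rewrite -lee_fin /Rintegral !fineK; last 2 first.
  - by apply: integrable_fin_num; [exact: mB|].
  - by apply: integrable_fin_num; [exact: mB|].
  rewrite -[leRHS]mul1e; apply: ge0_le_integral_scale => //.
  by move=> y _; rewrite mul1e.
have h2 : volume mu u (4 * delta) <= D ^+ 4 * volume mu x (delta / 2).
  apply: (volume_doubling borelX mu_ball D0 doubD) => //.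
  by have -> : 2 ^+ 4 = 16 :> R by [ring]; have := delta0; lra.
have h3 : volume mu x delta <= D * volume mu x (delta / 2).
  rewrite -[X in X * _](expr1 D); apply: (volume_doubling borelX mu_ball D0 doubD) => //.
  by rewrite /rho mdistxx expr1; have := delta0; lra.
have := ler_wpM2r o0 h2; have := ler_wpM2l (mulr_ge0 (ltW a0) o0) h3.
rewrite -/(volume mu x delta); lra.
Qed.

End bounded_function.

(* With [t] the [L^p]-average of [c], this replaces Jensen's inequality at the
   cost of a factor 2. *)
Lemma le_add_powR {R : realType} (p c t : R) : 1 <= p -> 0 <= c -> 0 < t ->
  c <= t + t * (c / t) `^ p.
Proof.
move=> p1 c0 t0; have q0 : 0 <= c / t by rewrite divr_ge0// ltW.
have [ct|tc] := leP (c / t) 1.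
  rewrite (@le_trans _ _ t)//; first by rewrite ler_pdivrMr// mul1r in ct.
  by rewrite lerDl mulr_ge0 ?powR_ge0// ltW.
rewrite -{1}(divfK (lt0r_neq0 t0) c) mulrC.
apply: (@le_trans _ _ (t * (c / t) `^ p)); last by rewrite lerDr ltW.
apply: ler_wpM2l; first exact: ltW.
rewrite -{1}(powRr1 q0); apply: ler_powR => //; exact: ltW.
Qed.

(** The sets may overlap: at each point of [B] at least one term of the sum equals [g]. *)
Lemma integral_le_sum_cover {R : realType} {d : measure_display}
    {T : measurableType d} (mu : {measure set T -> \bar R}) n (A : nat -> set T)
    (B : set T) (g : T -> R) :
  measurable B -> (forall i, (i < n)%N -> measurable (A i)) ->
  measurable_fun setT g -> (forall y, 0 <= g y) ->
  (forall y, B y -> exists2 i, (i < n)%N & A i y) ->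
  (\int[mu]_(y in B) (g y)%:E <= \sum_(i < n) \int[mu]_(y in A i) (g y)%:E)%E.
Proof.
move=> mB mA mg g0 cov.
have gA0 (i : 'I_n) y : (0 <= ((EFin \o g) \_ (A i)) y)%E.
  by apply: erestrict_ge0 => w _; rewrite lee_fin.
have -> : (\sum_(i < n) \int[mu]_(y in A i) (g y)%:E =
    1%:E * \int[mu]_y (\sum_(i < n) ((EFin \o g) \_ (A i)) y))%E.
  rewrite mul1e ge0_integral_sum//.
    by apply: eq_bigr => i _; rewrite integral_mkcond.
  move=> i; apply/(measurable_restrictT _ _).1; first exact: mA.
  by apply/measurable_EFinP; exact: measurable_funS mg.
apply: ge0_le_integral_scale => //.
- by move=> y _; rewrite lee_fin.
- by move=> y _; exact: sume_ge0.
- move=> y /cov[i ltin Aiy]; rewrite mul1e (bigD1 (Ordinal ltin))//=.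
  rewrite patchE mem_set//=; apply: leeDl.
  by apply: sume_ge0.
Qed.

(** * The estimate for bounded functions *)

Section bounded_estimate.
Context {R : realType} {d : measure_display} {X : metricMeasurableType R d}.
Variable mu : {measure set X -> \bar R}.
Hypothesis borelX : borel_compatible X.
Hypothesis mu_ball : balls_positive_finite mu.
Variables (delta D : R).
Hypothesis delta0 : 0 < delta.
Hypothesis D1 : 1 <= D.
Hypothesis doubD : doubling mu D.
Variables (f : X -> R) (M : R).
Hypothesis mf : measurable_fun setT f.
Hypothesis fM : forall x, `|f x| <= M.
Variables (p : R).
Hypothesis p1 : 1 <= p.
Variables (z : X) (s tau T : R).
Hypothesis tau2 : 2 <= tau.
Hypothesis delta_s : delta <= s.
Hypothesis T0 : 0 < T.
Let E := ball z (tau * s).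
(** [T] is any positive bound for the L^p average of the oscillation, not the average itself, which
    allows division by [T]. *)
Hypothesis osc_pow_int :
  (\int[mu]_(x in E) ((osc mu f x (4 * delta)) `^ p)%:E <=
   (T `^ p * volume mu z (tau * s))%:E)%E.

Let mB := measurable_metric_ball borelX.
Let a : R := 2 * D ^+ 4.
Let a0 : 0 < a. Proof. by rewrite mulr_gt0// exprn_gt0// (lt_le_trans _ D1). Qed.
Let s0 : 0 < s. Proof. exact: lt_le_trans delta_s. Qed.
Let taus0 : 0 < tau * s. Proof. by rewrite mulr_gt0// (lt_le_trans _ tau2). Qed.
Let p0 : 0 < p. Proof. exact: lt_le_trans p1. Qed.

Lemma smooth_approx :
  \int[mu]_(y in ball z s) `|f y - smooth mu delta f y| <=
  2 * (D ^+ 4 + a * D) * T * volume mu z (tau * s).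
Proof.
set g := fun y => `|f y - smooth mu delta f y|.
set b := D ^+ 4 + a * D.
have D0 : 0 < D := lt_le_trans ltr01 D1.
have b0 : 0 < b by rewrite addr_gt0 ?exprn_gt0 ?mulr_gt0.
have d20 : 0 < delta / 2 by rewrite divr_gt0.
have [n [x [xs xe cov]]] :=
  finite_separated_net borelX mu_ball z (ltW D0) doubD delta0 delta_s.
pose v i := volume mu (x i) (delta / 2).
have v0 i : 0 < v i by exact: volume_gt0.
pose I i := \int[mu]_(y in ball (x i) delta) g y.
(* [c i] is the constant that [smooth_approx_local] places below the oscillation on
   [ball (x i) (delta / 2)]. *)
pose c i := I i / (b * v i).
have I0 i : 0 <= I i by apply: Rintegral_ge0 => y _; exact: normr_ge0.
have c0 i : 0 <= c i by rewrite divr_ge0// ltW// mulr_gt0.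
have Ic i : I i = b * (c i * v i).
  by rewrite /c; field; rewrite !gt_eqF// v0.
have cT i : 0 <= c i / T by apply: divr_ge0; [exact: c0|exact: ltW].
have c_osc i u : ball (x i) (delta / 2) u -> c i <= osc mu f u (4 * delta).
  rewrite ball_rho /= => xu; rewrite ler_pdivrMr ?mulr_gt0//.
  have := smooth_approx_local borelX mu_ball delta0 D1 doubD mf fM xu.
  by rewrite mulrC.
have sub i : (i < n)%N -> ball (x i) (delta / 2) `<=` E.
  move=> ltin; apply: metric_ball_sub; have := xs _ ltin.
  have := ler_wpM2r (ltW s0) tau2; have := delta_s; have := delta0; lra.
have disj i j w : (i < n)%N -> (j < n)%N ->
    ball (x i) (delta / 2) w -> ball (x j) (delta / 2) w -> i = j.
  move=> lti ltj; rewrite !ball_rho /= => iw jw.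
  apply: contrapT => ij; have := xe _ _ lti ltj ij.
  by have := rho_triangle (x i) w (x j); rewrite (rho_sym w); lra.
have mA i : (i < n)%N -> measurable (ball (x i) (delta / 2)) /\
    ball (x i) (delta / 2) `<=` E.
  by move=> ltin; split; [exact: mB|exact: sub].
set V := volume mu z (tau * s).
have sumv : \sum_(i < n) v i <= V.
  have := @sum_mule_measure_le_integral _ _ _ mu n (fun i => ball (x i) (delta / 2))
    (fun=> 1) E (cst 1%E) mA disj.
  rewrite integral_cst ?mul1e; last exact: mB.
  rewrite volumeE// => H; rewrite -lee_fin -sumEFin; apply: le_trans (H _ _ _) => //.
  by rewrite le_eqVlt; apply/orP; left; apply/eqP; apply: eq_bigr => i _; rewrite mul1e volumeE.
(* The constants [c i]^ p[on disjoint balls lie below the p-th power of the oscillation, whose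
   integral is at most]T [^ p * V]. *)
have sumc : \sum_(i < n) (c i / T) `^ p * v i <= V.
  have Tp0 : 0 < T `^ p by rewrite powR_gt0.
  rewrite -(ler_pM2l Tp0) mulr_sumr -lee_fin -sumEFin.
  apply: le_trans osc_pow_int.
  have H := @sum_mule_measure_le_integral _ _ _ mu n (fun i => ball (x i) (delta / 2))
    (fun i => c i `^ p) E (fun u => ((osc mu f u (4 * delta)) `^ p)%:E) mA disj.
  apply: le_trans (H _ _ _).
  - rewrite le_eqVlt; apply/orP; left; apply/eqP; apply: eq_bigr => i _.
    rewrite volumeE// -EFinM mulrA -powRM ?cT ?(ltW T0)//.
    by rewrite mulrCA divff ?mulr1// gt_eqF.
  - by move=> i _; exact: powR_ge0.
  - by move=> y _; rewrite lee_fin powR_ge0.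
  - move=> i u _ xu; rewrite lee_fin.
    have cu := c_osc _ _ xu; apply: ge0_ler_powR => //; first exact: ltW.
      by rewrite nnegrE c0.
    by rewrite nnegrE (le_trans (c0 i)).
have mg : measurable_fun setT g.
  by apply: measurableT_comp => //; apply: measurable_funB => //;
    exact: (measurable_smooth borelX mu_ball delta0 D1 doubD mf fM).
have : \int[mu]_(y in ball z s) g y <= \sum_(i < n) I i.
  rewrite -lee_fin -sumEFin /Rintegral fineK; last first.
    apply: integrable_fin_num; first exact: mB.
    exact: (integrable_sub_smooth borelX mu_ball delta0 D1 doubD mf fM).
  apply: le_trans (integral_le_sum_cover (n := n) (A := fun i => ball (x i) delta) _ _ _ _ _ _) _.
  - exact: mB.
  - by move=> i _; exact: mB.
  - exact: mg.
  - by move=> y; exact: normr_ge0.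
  - by move=> y; rewrite ball_rho /= => /cov[i ltin xy]; exists i => //; rewrite ball_rho.
  rewrite le_eqVlt; apply/orP; left; apply/eqP; apply: eq_bigr => i _.
  rewrite /I /Rintegral fineK//; apply: integrable_fin_num; first exact: mB.
  exact: (integrable_sub_smooth borelX mu_ball delta0 D1 doubD mf fM).
move=> /le_trans; apply.
under eq_bigr do rewrite Ic.
rewrite -mulr_sumr -!mulrA mulrCA; apply: ler_wpM2l; first exact: ltW.
(* [le_add_powR] splits each [c i] in two; by [sumv] and [sumc] each part sums to at most [T * V],
   hence the factor 2. *)
apply: (@le_trans _ _ (\sum_(i < n) (T * v i + T * ((c i / T) `^ p * v i)))).
  apply: ler_sum => i _; have := le_add_powR p1 (c0 i) T0 => /(ler_wpM2r (ltW (v0 i))).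
  by rewrite mulrDl mulrA.
rewrite big_split/= -!mulr_sumr.
have := ler_wpM2l (ltW T0) sumv; have := ler_wpM2l (ltW T0) sumc; lra.
Qed.

Variables (lambda cP : R) (k : nat).
Hypothesis lambda1 : 1 <= lambda.
Hypothesis lambda_tau : lambda <= tau.
Hypothesis tau_k : tau <= 2 ^+ k.
Hypothesis cP0 : 0 < cP.
Hypothesis poincareX : poincare mu p lambda cP.

(** [k] doublings take the radius [s] to at least [tau * s]. The case [t = 1] serves the
    approximation error, [t = lambda] the ball in the Poincare inequality. *)
Let V_doub t : 1 <= t -> volume mu z (tau * s) <= D ^+ k * volume mu z (t * s).
Proof.
move=> t1; have ts0 : 0 < t * s by rewrite mulr_gt0// (lt_le_trans _ t1).
apply: (volume_doubling borelX mu_ball _ doubD) => //.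
  exact: le_trans D1.
rewrite /rho mdistxx add0r mulrA; apply: ler_wpM2r; first exact: ltW.
by apply: le_trans tau_k _; rewrite ler_peMr// exprn_ge0.
Qed.

(** The Poincare inequality is applied to the smoothed function, whose pointwise Lipschitz constant
    is at most [K] times the oscillation of [f]. The factor [D ^+ k] pays for enlarging the ball of
    radius [lambda * s] to [E]. *)
Lemma osc_smooth_le :
  osc mu (smooth mu delta f) z s <= cP * s * ((a + a ^+ 2) / delta) * T * D ^+ k.
Proof.
set K := (a + a ^+ 2) / delta.
have K0 : 0 < K by rewrite divr_gt0// addr_gt0// exprn_gt0.
have Dk1 : 1 <= D ^+ k by rewrite exprn_ege1.
have Dk0 : 0 < D ^+ k := lt_le_trans ltr01 Dk1.
have ls0 : 0 < lambda * s by rewrite mulr_gt0// (lt_le_trans _ lambda1).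
have isg := integrable_smooth borelX mu_ball delta0 D1 doubD mf fM z s0.
rewrite -lee_fin -mean_oscE//.
apply: le_trans (poincareX
  (smooth_lipschitz borelX mu_ball delta0 D1 doubD mf fM) z s0) _.
rewrite (_ : cP * s * K * T * D ^+ k = cP * s * (K * (T * D ^+ k))); last by rewrite !mulrA.
rewrite [X in (_ <= X)%E]EFinM; apply: lee_wpmul2l.
  by rewrite lee_fin mulr_ge0// ltW.
(* The volume ratio is absorbed into a p-th power, so that the p-th root returns [D ^+ k]. *)
have Dp : D ^+ k <= (D ^+ k) `^ p.
  by rewrite -{1}(powRr1 (ltW Dk0)); exact: ler_powR.
have TD0 : 0 <= T * D ^+ k by apply: mulr_ge0; exact: ltW.
have KTD : 0 <= K * (T * D ^+ k) by apply: mulr_ge0 => //; exact: ltW.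
have -> : ((K * (T * D ^+ k))%:E = (((K * (T * D ^+ k)) `^ p)%:E) `^ p^-1)%E.
  by rewrite poweR_EFin -powRrM divff ?gt_eqF// powRr1.
apply: gt0_ler_poweR.
- by rewrite invr_ge0 ltW.
- rewrite in_itv/= leey andbT /average volumeE// mule_ge0//.
    by rewrite inver gt_eqF ?volume_gt0// lee_fin invr_ge0 ltW// volume_gt0.
  by apply: integral_ge0 => x _; exact: poweR_ge0.
- by rewrite in_itv/= leey andbT lee_fin powR_ge0.
have V0 := volume_gt0 mu_ball z ls0.
rewrite /average volumeE// inver gt_eqF//.
rewrite -(@lee_pmul2l _ (volume mu z (lambda * s))%:E)// ?lte_fin//.
rewrite muleA -EFinM divff ?gt_eqF// mul1e.
apply: (@le_trans _ _ ((K `^ p)%:E *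
    \int[mu]_(x in E) ((osc mu f x (4 * delta)) `^ p)%:E)%E).
  apply: ge0_le_integral_scale.
  - exact: powR_gt0.
  - by apply: metric_ball_sub; rewrite /rho mdistxx add0r; apply: ler_wpM2r => //; exact: ltW.
  - by move=> x _; exact: poweR_ge0.
  - by move=> x _; rewrite lee_fin powR_ge0.
  - move=> x _; have r1 : 0 < 4 * delta by rewrite mulr_gt0.
    have o0 : 0 <= osc mu f x (4 * delta).
      by apply: osc_ge0 => //; exact: bounded_integrable_ball.
    rewrite -EFinM -powRM ?(ltW K0)// -poweR_EFin.
    apply: gt0_ler_poweR; first exact: ltW.
    + by rewrite in_itv/= leey andbT lip_ge0.
    + by rewrite in_itv/= leey andbT lee_fin mulr_ge0// ltW.
    + exact: (lip_smooth_le borelX mu_ball delta0 D1 doubD mf fM).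
apply: le_trans (lee_wpmul2l _ osc_pow_int) _; first by rewrite lee_fin powR_ge0.
rewrite -!EFinM lee_fin (powRM p (ltW K0) TD0) (powRM p (ltW T0) (ltW Dk0)).
rewrite [leRHS](_ : _ = K `^ p * (T `^ p *
  ((D ^+ k) `^ p * volume mu z (lambda * s)))); last by ring.
do 2 (apply: ler_wpM2l; first exact: powR_ge0).
apply: le_trans (V_doub lambda1) _; apply: ler_wpM2r => //; exact: ltW.
Qed.

(** [osc_le_add] compares [f] with its smoothing. The Poincare term already carries [s / delta]; the
    approximation error is multiplied by this ratio, which is at least 1. *)
Lemma osc_bounded_le : osc mu f z s <=
  (cP * (a + a ^+ 2) + 4 * (D ^+ 4 + a * D)) * D ^+ k * (s / delta) * T.
Proof.
have V0 := volume_gt0 mu_ball z s0.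
have ifz := bounded_integrable_ball borelX mu_ball mf fM z s0.
have igz := integrable_smooth borelX mu_ball delta0 D1 doubD mf fM z s0.
rewrite -(ler_pM2l V0).
apply: le_trans (osc_le_add borelX mu_ball s0 ifz igz) _.
rewrite -osc_integral//.
have h1 := ler_wpM2l (ltW V0) osc_smooth_le.
have b0 : 0 <= D ^+ 4 + a * D.
  by have D0 := le_trans ler01 D1; rewrite addr_ge0 ?exprn_ge0// mulr_ge0// ltW.
have h2 : \int[mu]_(y in ball z s) `|f y - smooth mu delta f y| <=
    2 * (D ^+ 4 + a * D) * T * (D ^+ k * volume mu z s * (s / delta)).
  apply: le_trans smooth_approx _; apply: ler_wpM2l.
    by rewrite !mulr_ge0// ltW.
  have := V_doub (lexx 1); rewrite mul1r => /le_trans; apply.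
  rewrite ler_peMr//; last by rewrite ler_pdivlMr// mul1r.
  by rewrite mulr_ge0 ?(ltW V0)// exprn_ge0// (le_trans ler01).
apply: (@le_trans _ _ (volume mu z s * (cP * s * ((a + a ^+ 2) / delta) * T * D ^+ k) +
   2 * (2 * (D ^+ 4 + a * D) * T * (D ^+ k * volume mu z s * (s / delta))))).
  by apply: lerD => //; apply: ler_wpM2l.
by rewrite le_eqVlt; apply/orP; left; apply/eqP; rewrite /a; field; rewrite gt_eqF.
Qed.

End bounded_estimate.

(** * Truncation of real values and of integrable functions *)

Section truncation.
Context {R : realType}.

Definition truncate (M t : R) : R := Num.max (- M) (Num.min M t).

Variable M : R.
Hypothesis M0 : 0 <= M.

Lemma truncate_cases (t : R) : [\/ truncate M t = - M /\ t <= - M,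
  truncate M t = t /\ - M <= t <= M | truncate M t = M /\ M <= t].
Proof.
have M0' := M0; rewrite /truncate; have [Mt|tM] := leP M t.
  by apply: Or33; rewrite max_r//; lra.
have [Mt|tM'] := leP (- M) t; first by apply: Or32; rewrite ltW.
by apply: Or31; rewrite ltW.
Qed.

Lemma truncate_norm_le (t : R) : `|truncate M t| <= M.
Proof.
have M0' := M0; rewrite ler_norml.
by case: (truncate_cases t) => -[-> ?] //; lra.
Qed.

Lemma truncate_id (t : R) : `|t| <= M -> truncate M t = t.
Proof.
have M0' := M0; rewrite ler_norml.
by case: (truncate_cases t) => -[-> ?] //; lra.
Qed.

Lemma truncate_lip (t u : R) : `|truncate M t - truncate M u| <= `|t - u|.
Proof.
have M0' := M0; have h1 := ler_norm (t - u); have h2 := ler_norm (u - t).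
rewrite distrC in h2; rewrite ler_norml.
by case: (truncate_cases t) => -[-> ?]; case: (truncate_cases u) => -[-> ?]; lra.
Qed.

Lemma truncate_le_norm (t : R) : `|truncate M t| <= `|t|.
Proof. by have := truncate_lip t 0; rewrite (@truncate_id 0) ?normr0// !subr0. Qed.

End truncation.

Section truncated_function.
Context {R : realType} {d : measure_display} {T : measurableType d}.

Lemma measurable_truncate (f : T -> R) M :
  measurable_fun setT f -> measurable_fun setT (truncate M \o f).
Proof.
move=> mf; apply: measurable_maxr; first exact: measurable_cst.
by apply: measurable_minr => //; exact: measurable_cst.
Qed.

(** Dominated convergence with majorant [|f|]: at each [y] the truncations equal [f y] once [n]
    reaches [|f y|]. *)
Lemma truncate_approx (mu : {measure set T -> \bar R}) (B : set T) (f : T -> R) (e : R) :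
  measurable B -> measurable_fun setT f -> mu.-integrable B (EFin \o f) -> 0 < e ->
  exists n : nat, \int[mu]_(y in B) `|f y - truncate n%:R (f y)| <= e.
Proof.
move=> mB mf intf e0.
pose fn n y := (truncate n%:R (f y))%:E.
have mfn n : measurable_fun B (fn n).
  by apply/measurable_EFinP; apply: measurable_funS (measurable_truncate _ mf).
have ig := integrable_norm intf.
have [_ cv _] : [/\ mu.-integrable B (EFin \o f),
    [sequence \int[mu]_(x in B) `|fn n x - (EFin \o f) x|]_n @ \oo --> 0%E &
    [sequence \int[mu]_(x in B) fn n x]_n @ \oo --> \int[mu]_(x in B) (EFin \o f) x]%E.
  apply: (dominated_convergence mB mfn _ _ ig).
  - exact: measurable_int intf.
  - apply: aeW => y _; apply: cvg_near_cst.
    exists (Num.bound `|f y|) => // n /= Nn; rewrite /fn truncate_id//.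
    by rewrite (le_trans (ltW (archi_boundP _)))// ler_nat.
  - by apply: aeW => y n _; rewrite /fn /= lee_fin truncate_le_norm.
have e0' : (0 < e%:E)%E by rewrite lte_fin.
have [N _ HN] := cv _ (open_ereal_lt' e0').
exists N; have /= lteN := HN N (leqnn N).
have lte : (\int[mu]_(y in B) (`|f y - truncate N%:R (f y)|)%:E < e%:E)%E.
  apply: le_lt_trans lteN; rewrite le_eqVlt; apply/orP; left; apply/eqP.
  by apply: eq_integral => y _; rewrite distrC.
rewrite -lee_fin /Rintegral fineK; first exact: ltW.
rewrite ge0_fin_numE; first by rewrite (lt_trans lte)// ltry.
by apply: integral_ge0 => y _; rewrite lee_fin.
Qed.

End truncated_function.

(** * From bounded to locally integrable functions *)

Section locally_integrable_estimate.
Context {R : realType} {d : measure_display} {X : metricMeasurableType R d}.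
Variable mu : {measure set X -> \bar R}.
Hypothesis borelX : borel_compatible X.
Hypothesis mu_ball : balls_positive_finite mu.
Variables (delta D : R).
Hypothesis delta0 : 0 < delta.
Hypothesis D1 : 1 <= D.
Hypothesis doubD : doubling mu D.
Variables (f : X -> R).
Hypothesis intf : L1loc mu f.

Let mB := measurable_metric_ball borelX.
Let a : R := 2 * D ^+ 4.
Let a0 : 0 < a. Proof. by rewrite mulr_gt0// exprn_gt0// (lt_le_trans _ D1). Qed.

(** By [osc_le] the truncation may be compared with the constant [truncate M m], [m] being the mean
    of [f], and truncation is 1-Lipschitz. *)
Lemma osc_truncate_le (M : R) x r : 0 <= M -> 0 < r ->
  osc mu (truncate M \o f) x r <= 2 * osc mu f x r.
Proof.
move=> M0 r0; have [mf /(_ x r r0) intfx] := intf.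
have mM : measurable_fun setT (truncate M \o f) by exact: measurable_truncate.
have V0 := volume_gt0 mu_ball x r0.
have bM y : `|(truncate M \o f) y| <= M by exact: truncate_norm_le.
have iM := bounded_integrable_ball borelX mu_ball mM bM x r0.
set m := mean mu f (ball x r).
have h : volume mu x r * osc mu (truncate M \o f) x r <=
    2 * (volume mu x r * osc mu f x r).
  apply: le_trans (osc_le borelX mu_ball r0 iM (truncate M m)) _.
  rewrite (osc_integral borelX mu_ball r0 intfx); apply: ler_wpM2l => //.
  apply: le_Rintegral; first exact: mB.
  - exact: integrable_norm_dist.
  - exact: integrable_norm_dist.
  - by move=> y _; exact: truncate_lip.
move: (volume mu x r) (osc mu (truncate M \o f) x r) (osc mu f x r) V0 h => V A B V0 h.
by rewrite -(ler_pM2l V0) mulrCA.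
Qed.

Variables (p : R).
Hypothesis p1 : 1 <= p.
Variables (z : X) (s tau T : R).
Hypothesis tau2 : 2 <= tau.
Hypothesis delta_s : delta <= s.
Hypothesis T0 : 0 <= T.
Hypothesis osc_pow_int :
  (\int[mu]_(x in ball z (tau * s)) ((osc mu f x (4 * delta)) `^ p)%:E <=
   (T `^ p * volume mu z (tau * s))%:E)%E.
Variables (lambda cP : R) (k : nat).
Hypothesis lambda1 : 1 <= lambda.
Hypothesis lambda_tau : lambda <= tau.
Hypothesis tau_k : tau <= 2 ^+ k.
Hypothesis cP0 : 0 < cP.
Hypothesis poincareX : poincare mu p lambda cP.

Let C := (cP * (a + a ^+ 2) + 4 * (D ^+ 4 + a * D)) * D ^+ k.

Lemma osc_L1loc_le : osc mu f z s <= 2 * C * (s / delta) * T.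
Proof.
have s0 : 0 < s := lt_le_trans delta0 delta_s.
have p0 : 0 < p := lt_le_trans ltr01 p1.
have D0 : 0 < D := lt_le_trans ltr01 D1.
have r0 : 0 < 4 * delta by rewrite mulr_gt0.
have taus0 : 0 < tau * s by rewrite mulr_gt0// (lt_le_trans _ tau2).
have V0 := volume_gt0 mu_ball z s0.
have [mf locf] := intf; have intfz := locf z s s0.
have C0 : 0 < C.
  apply: mulr_gt0; last exact: exprn_gt0.
  apply: addr_gt0; apply: mulr_gt0 => //; apply: addr_gt0 => //.
  - exact: exprn_gt0.
  - exact: exprn_gt0.
  - exact: mulr_gt0.
set K := 2 * C * (s / delta); have K0 : 0 < K.
  by apply: mulr_gt0; [exact: mulr_gt0|exact: divr_gt0].
apply/ler_addgt0Pr => e e0.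
(* [T'] is positive even if [T = 0], and [K * T'] exceeds [K * T] by only [e / 2]. *)
pose T' := T + e / (2 * K).
have TT' : T < T' by rewrite ltrDl divr_gt0// mulr_gt0.
have T'0 : 0 < T' by exact: le_lt_trans TT'.
(* The factor 2 in [osc_le_add] turns this error into the other [e / 2], times the volume. *)
have eV0 : 0 < e * volume mu z s / 4 by rewrite divr_gt0// mulr_gt0.
have [n Hn] := truncate_approx (mB z s) mf intfz eV0.
pose g := truncate n%:R \o f.
have n0 : 0 <= n%:R :> R by [].
have mg : measurable_fun setT g by exact: measurable_truncate.
have bg y : `|g y| <= n%:R by exact: truncate_norm_le.
have igz := bounded_integrable_ball borelX mu_ball mg bg z s0.
(* Truncation at most doubles the oscillation, so [2 * T'] takes the role of [T]; this is the 2 in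
   the final constant. *)
have osc_g : (\int[mu]_(x in ball z (tau * s)) ((osc mu g x (4 * delta)) `^ p)%:E <=
    ((2 * T') `^ p * volume mu z (tau * s))%:E)%E.
  apply: (@le_trans _ _ ((2 `^ p)%:E *
      \int[mu]_(x in ball z (tau * s)) ((osc mu f x (4 * delta)) `^ p)%:E)%E).
    apply: ge0_le_integral_scale => //.
    - by move=> x _; rewrite lee_fin powR_ge0.
    - by move=> x _; rewrite lee_fin powR_ge0.
    - move=> x _; have of0 : 0 <= osc mu f x (4 * delta) by apply: osc_ge0 => //; exact: locf.
      have og0 : 0 <= osc mu g x (4 * delta).
        by apply: osc_ge0 => //; exact: (bounded_integrable_ball borelX mu_ball mg bg).
      rewrite -EFinM lee_fin -powRM//; apply: ge0_ler_powR; rewrite ?nnegrE ?(ltW p0)//.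
        exact: (mulr_ge0 (ler0n _ 2) of0).
      exact: osc_truncate_le.
  apply: le_trans (lee_wpmul2l _ osc_pow_int) _; first by rewrite lee_fin powR_ge0.
  rewrite -EFinM lee_fin powRM ?(ltW T'0)// mulrA; apply: ler_wpM2r.
    by rewrite ltW// volume_gt0.
  apply: ler_wpM2l; first exact: powR_ge0.
  by apply: ge0_ler_powR; rewrite ?nnegrE ?(ltW p0) ?(ltW T'0) ?(ltW TT').
have T20 : 0 < 2 * T' by rewrite mulr_gt0.
have := osc_bounded_le borelX mu_ball delta0 D1 doubD mg bg p1 tau2 delta_s T20 osc_g
  lambda1 lambda_tau tau_k cP0 poincareX.
rewrite -/a -/C => og.
rewrite -(ler_pM2l V0); apply: le_trans (osc_le_add borelX mu_ball s0 intfz igz) _.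
rewrite -osc_integral//.
have := ler_wpM2l (ltW V0) og.
have -> : C * (s / delta) * (2 * T') = K * T + e / 2.
  have aux (c : R) : 0 < c -> c * (T + e / (2 * c)) = c * T + e / 2.
    by move=> c0; field; rewrite gt_eqF.
  by rewrite -(aux K K0) -/T' /K; ring.
have := Hn; rewrite -/(g _); lra.
Qed.

End locally_integrable_estimate.

(** * The choice of constants and the passage to extended real values *)

Theorem theorem3p4 (R : realType) (p cmu lambda cP : R)
    (p_ge1 : 1 <= p) (lambda_ge1 : 1 <= lambda) (cP_gt0 : 0 < cP) :
  exists2 C : R, 0 < C &
    forall (d : measure_display) (X : metricMeasurableType R d)
      (mu : {measure set X -> \bar R}),
    borel_compatible X ->
    balls_positive_finite mu ->
    doubling mu cmu ->
    poincare mu p lambda cP ->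
    forall f : X -> R, L1loc mu f ->
    forall (z : X) (r s : R), 0 < r -> r < s ->
      (mean_osc mu f z s <=
       (C * (s / r))%:E *
         (average mu (ball z (Num.max 2 lambda * s)%R)
            (fun x => mean_osc mu f x r `^ p)) `^ p^-1)%E.
Proof.
(* Raising the doubling constant to at least 1 keeps its powers at least 1. *)
pose D := Num.max 1 cmu; pose tau := Num.max 2 lambda.
have D1 : 1 <= D by rewrite le_max lexx.
have D0 : 0 < D := lt_le_trans ltr01 D1.
have tau2 : 2 <= tau by rewrite le_max lexx.
have p0 : 0 < p := lt_le_trans ltr01 p_ge1.
have tau0 : 0 <= tau by exact: le_trans tau2.
pose k := Num.bound tau.
have tau_k : tau <= 2 ^+ k.
  by rewrite (le_trans (ltW (archi_boundP tau0)))// -natrX ler_nat ltnW// ltn_expl.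
pose a := 2 * D ^+ 4.
have a0 : 0 < a by rewrite mulr_gt0// exprn_gt0.
pose C := (cP * (a + a ^+ 2) + 4 * (D ^+ 4 + a * D)) * D ^+ k.
have C0 : 0 < C.
  by rewrite /C mulr_gt0 ?addr_gt0 ?mulr_gt0 ?addr_gt0 ?exprn_gt0 ?mulr_gt0.
(* The factor 8 is 2 from truncation times 4 from [delta = r / 4]. *)
exists (8 * C); first by rewrite mulr_gt0.
move=> d X mu borelX mu_ball doubX poincareX f intf z r s r0 rs.
have s0 : 0 < s := lt_trans r0 rs.
have doubD : doubling mu D.
  move=> x t t0; apply: le_trans (doubX x t t0) _.
  by apply: lee_wpmul2r => //; rewrite lee_fin le_max lexx orbT.
have [_ locf] := intf.
have oscE x t : 0 < t -> mean_osc mu f x t = (osc mu f x t)%:E.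
  by move=> t0; apply: mean_oscE => //; exact: locf.
under [X in average _ _ X]eq_fun do rewrite oscE// poweR_EFin.
rewrite oscE// -/tau.
have taus0 : 0 < tau * s by rewrite mulr_gt0// (lt_le_trans _ tau2).
have V0 := volume_gt0 mu_ball z taus0.
have Cs0 : 0 < 8 * C * (s / r).
  by apply: mulr_gt0; [exact: mulr_gt0|exact: divr_gt0].
set I := average _ _ _.
have I0 : (0 <= I)%E.
  rewrite /I /average volumeE// inver gt_eqF// mule_ge0// ?lee_fin ?invr_ge0 ?(ltW V0)//.
  by apply: integral_ge0 => x _; rewrite lee_fin powR_ge0.
(* An infinite average makes the right-hand side infinite, because its constant factor is
   positive. *)
have [Ioo|Ifin] := eqVneq I +oo%E.
  by rewrite Ioo poweRyr ?invr_eq0 ?gt_eqF// gt0_muley ?lte_fin// leey.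
have If : I \is a fin_num by rewrite ge0_fin_numE// lt_neqAle Ifin leey.
rewrite -(fineK If) poweR_EFin -EFinM lee_fin.
(* Here [T] is the L^p average itself, so [osc_pow_int] holds with equality. *)
pose T := fine I `^ p^-1.
have Tp : T `^ p = fine I.
  by rewrite /T -powRrM mulVf ?gt_eqF// powRr1// fine_ge0.
have delta0 : 0 < r / 4 by rewrite divr_gt0.
have er : 4 * (r / 4) = r by field.
have delta_s : r / 4 <= s by lra.
have osc_pow_int : (\int[mu]_(x in ball z (tau * s)) ((osc mu f x (4 * (r / 4))) `^ p)%:E <=
   (T `^ p * volume mu z (tau * s))%:E)%E.
  rewrite er Tp (mulrC (fine I)) EFinM (fineK If) /I /average volumeE// inver gt_eqF//.
  by rewrite muleA -EFinM divff ?gt_eqF// mul1e.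
have lambda_tau : lambda <= tau by rewrite le_max lexx orbT.
have := osc_L1loc_le borelX mu_ball delta0 D1 doubD intf p_ge1 tau2 delta_s
  (powR_ge0 _ _) osc_pow_int lambda_ge1 lambda_tau tau_k cP_gt0 poincareX.
move=> /le_trans; apply; rewrite le_eqVlt; apply/orP; left; apply/eqP.
by rewrite -/T /C /a; field; rewrite gt_eqF.
Qed.
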